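(* Let $R=(R_t)_{t\ge0}$ be a Lévy process with Lévy–Itô decomposition $$R_t=\mu t+\sigma B_t+\int_0^t\int_{0<|x|\le1}x\big(\mu^R(dx,ds)-F^R(dx)\,ds\big)+\int_0^t\int_{|x|>1}x\,\mu^R(dx,ds),$$ and assume $\mathbb{E}|R_1|<\infty$. Denote $$g_R(f)=f\bigg(\mu+\int_{|x|>1}x\,F^R(dx)\bigg)+\frac{f(1-f)\sigma^2}{2}+\int_{\mathbb{R}\setminus\{0\}}\Big[\ln\big(1+f(e^x-1)\big)-fx\Big]F^R(dx),$$ and assume that $$\lim_{f\to0+}\int_{\mathbb{R}\setminus\{0\}}\left(\frac{e^x-1}{1+f(e^x-1)}-x\right)F^R(dx)>-\bigg(\mu+\frac{\sigma^2}{2}+\int_{|x|>1}x\,F^R(dx)\bigg),$$ $$\lim_{f\to1-}\int_{\mathbb{R}\setminus\{0\}}\left(\frac{e^x-1}{1+f(e^x-1)}-x\right)F^R(dx)<-\bigg(\mu+\int_{|x|>1}x\,F^R(dx)\bigg).$$ Then there exists a unique $f^*\in(0,1)$ such that $$g_R(f)<g_R(f^* )$$ for all $f\neq f^*$ in the domain of $g_R$.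
   Context: Here $\mu\in\mathbb{R}$, $\sigma\ge0$, $B$ is a standard Brownian motion, $\mu^R(dx,ds)=\sum_{s>0:\,\triangle R_s\neq0}\delta_{(\triangle R_s,s)}(dx,ds)$ is the jump measure of $R$ (with $\triangle R_s=R_s-R_{s-}$), and $F^R$ is the Lévy measure of $R$ on $\mathbb{R}\setminus\{0\}$. The domain of $g_R$ is the set of real $f$ for which the formula makes sense, that is, $1+f(e^x-1)>0$ for $F^R$-almost every $x$ and $\int|\ln(1+f(e^x-1))-fx|\,F^R(dx)<\infty$; it contains $[0,1]$. Limits are understood in the extended real line. *)

(* Defs.v *)
From HB Require Import structures.
From mathcomp Require Import all_boot all_order all_algebra.
From mathcomp Require Import all_classical all_reals all_analysis.
From mathcomp Require Import measurable_realfun.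

Set Implicit Arguments.
Unset Strict Implicit.
Unset Printing Implicit Defensive.
Import Order.TTheory GRing.Theory Num.Theory.
Import numFieldNormedType.Exports.
Local Open Scope classical_set_scope.
Local Open Scope ring_scope.

(* Real-time processes are functions X : R -> T -> R (time first, outcome
   second); only the times t >= 0 are ever constrained. *)

Section path.
Context {R : realType}.
Implicit Type x : R -> R.

Definition cadlag x : Prop :=
  (forall t, 0 <= t -> x s @[s --> t^'+] --> x t) /\
  (forall t, 0 < t -> cvg (x s @[s --> t^'-])).

Definition jump x (t : R) : R := x t - lim (x s @[s --> t^'-]).

(* Integer-valued measure of the points (jump size, jump time): the space
   variable is the first component and the time variable the second one. *)
Definition jump_measure x :
    set (measurableTypeR R * measurableTypeR R)%type -> \bar R :=
  fun C => (\esum_(s in [set s : R | ((0 < s) && (jump x s != 0))%R])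
              \d_((jump x s, s) : measurableTypeR R * measurableTypeR R) C)%E.

Let jump_measure0 x : jump_measure x set0 = 0%E.
Proof. by apply: esum1 => s _; rewrite measure0. Qed.

Let jump_measure_ge0 x C : (0 <= jump_measure x C)%E.
Proof. exact: esum_ge0. Qed.

Let jump_measure_sigma_additive x : semi_sigma_additive (jump_measure x).
Proof.
move=> C mC tC mUC.
suff -> : jump_measure x (\bigcup_n C n) =
    (\sum_(0 <= n <oo) jump_measure x (C n))%E.
  by apply: is_cvg_nneseries => n _ _; exact: jump_measure_ge0.
rewrite nneseries_esumT; last by move=> n; exact: jump_measure_ge0.
rewrite /jump_measure; set J := [set s | _].
transitivity (\esum_(s in J) \esum_(n in [set: nat])
    (\d_((jump x s, s) : measurableTypeR R * measurableTypeR R) (C n)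
       : \bar R))%E.
  by apply: eq_esum => s _; rewrite measure_semi_bigcup// nneseries_esumT.
rewrite !esum_esum//.
rewrite (@reindex_esum _ _ _ (J `*`` fun=> setT) _ (fun k => (k.2, k.1)))//.
split=> [[s n] [Js _]|[s n] [s' n'] _ _ [-> ->]|[n s] [_ Js]] //.
by exists (s, n).
Qed.

HB.instance Definition _ x := isMeasure.Build _ _ _ (jump_measure x)
  (jump_measure0 x) (jump_measure_ge0 x) (@jump_measure_sigma_additive x).

End path.

Section processes.
Context {R : realType} d {T : measurableType d} (P : probability T R).
Implicit Types (X B M : R -> T -> R) (mu sigma : R)
  (F : {measure set (measurableTypeR R) -> \bar R}).

Definition increment X (s t : R) : T -> R := X t \- X s.

Definition independent_increments X : Prop :=
  forall (n : nat) (t : nat -> R) (A : nat -> set (measurableTypeR R)),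
    0 <= t 0%N -> (forall i, t i <= t i.+1) -> (forall i, measurable (A i)) ->
    P (\bigcap_(i < n) (increment X (t i) (t i.+1) @^-1` A i)) =
    (\prod_(i < n) P (increment X (t i) (t i.+1) @^-1` A i))%E.

Record levy_process X : Prop := LevyProcess {
  levy_measurable : forall t, 0 <= t -> measurable_fun setT (X t) ;
  levy_start : {ae P, forall w, X 0 w = 0} ;
  levy_cadlag : forall w, cadlag (X ^~ w) ;
  levy_independent : independent_increments X ;
  levy_stationary : forall (s h : R) (A : set (measurableTypeR R)),
    0 <= s -> 0 <= h -> measurable A ->
    P (increment X s (s + h) @^-1` A) = P (increment X 0 h @^-1` A) }.

Record brownian_motion B : Prop := BrownianMotion {
  brownian_measurable : forall t, 0 <= t -> measurable_fun setT (B t) ;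
  brownian_start : {ae P, forall w, B 0 w = 0} ;
  brownian_continuous :
    {ae P, forall w, {within `[0, +oo[, continuous (B ^~ w)}} ;
  brownian_independent : independent_increments B ;
  (* the second argument of normal_prob is the standard deviation *)
  brownian_gaussian : forall (s t : R) (A : set (measurableTypeR R)),
    0 <= s -> s < t -> measurable A ->
    P (increment B s t @^-1` A) = normal_prob 0 (Num.sqrt (t - s)) A }.

(* A measure on R \ {0} is encoded as a measure on R that does not charge 0. *)
Definition levy_measure F : Prop :=
  F [set 0] = 0%E /\
  (\int[F]_x (Num.min 1 (x ^+ 2))%:E < +oo)%E.

(* F(A) is the expected number of jumps with size in A per unit of time. *)
Definition levy_measure_of X F : Prop :=
  levy_measure F /\
  forall A : set (measurableTypeR R), measurable A ->
    F A = (\int[P]_w jump_measure (X ^~ w) (A `*` [set` `]0%R, 1%R]]))%E.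

Definition sigma_brownian B : set (set T) :=
  <<s [set E | exists t (A : set (measurableTypeR R)),
         [/\ 0 <= t, measurable A & E = B t @^-1` A] ] >>.

Definition sigma_jumps X : set (set T) :=
  <<s [set E | exists (C : set (measurableTypeR R * measurableTypeR R)%type)
                      (U : set (\bar R)),
         [/\ measurable C, measurable U &
             E = (fun w => jump_measure (X ^~ w) C) @^-1` U] ] >>.

Definition independent_sigma (G H : set (set T)) : Prop :=
  forall D E, G D -> H E -> P (D `&` E) = (P D * P E)%E.

Definition small_jumps_truncated X F (e t : R) (w : T) : R :=
  Rintegral (jump_measure (X ^~ w))
    [set z | (e < `|z.1| <= 1) && (0 < z.2 <= t)] fst -
  t * \int[F]_(x in [set x | e < `|x| <= 1]) x.

(* The integral of x 1_{0 < |x| <= 1} against the compensated jump measure is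
   a stochastic integral: it does not exist pathwise in general, and is the
   L^2 limit of the integrals over e < |x| <= 1 as e -> 0+. *)
Definition compensated_small_jumps X F M : Prop :=
  forall t, 0 <= t -> measurable_fun setT (M t) /\
    (\int[P]_w ((small_jumps_truncated X F e t w - M t w) ^+ 2)%:E)%E
      @[e --> 0^'+] --> 0%E.

Definition big_jumps X (t : R) (w : T) : R :=
  Rintegral (jump_measure (X ^~ w))
    [set z | (1 < `|z.1|) && (0 < z.2 <= t)] fst.

Record levy_ito X mu sigma B F : Prop := LevyIto {
  levy_ito_brownian : brownian_motion B ;
  levy_ito_measure : levy_measure_of X F ;
  levy_ito_independent : independent_sigma (sigma_brownian B) (sigma_jumps X) ;
  levy_ito_eq : exists2 M, compensated_small_jumps X F M &
    forall t, 0 <= t -> {ae P, forall w,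
      X t w = mu * t + sigma * B t w + M t w + big_jumps X t w} }.

End processes.

Section growth.
Context {R : realType}.
Implicit Types (mu sigma f : R)
  (F : {measure set (measurableTypeR R) -> \bar R}).

Definition growth_rate mu sigma F f : R :=
  f * (mu + \int[F]_(x in [set x | 1 < `|x|]) x)
  + f * (1 - f) * sigma ^+ 2 / 2
  + \int[F]_(x in [set x | x != 0]) (ln (1 + f * (expR x - 1)) - f * x).

Definition growth_rate_domain F : set R :=
  [set f | {ae F, forall x : R, 0 < 1 + f * (expR x - 1)} /\
    (\int[F]_(x in [set x | x != 0%R])
       `|ln (1 + f * (expR x - 1)) - f * x|%:E < +oo)%E].

(* Extended-real valued: the integral may be infinite. *)
Definition marginal_jump_integral F f : \bar R :=
  (\int[F]_(x in [set x | x != 0%R])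
     ((expR x - 1) / (1 + f * (expR x - 1)) - x)%:E)%E.

Definition big_jump_mean F : \bar R :=
  (\int[F]_(x in [set x | (1 < `|x|)%R]) x%:E)%E.

End growth.

(* Main.v *)
Require Import Defs.
From HB Require Import structures.
From mathcomp Require Import all_boot all_order all_algebra.
From mathcomp Require Import all_classical all_reals all_analysis.
From mathcomp Require Import ring lra measurable_realfun.
Import Order.TTheory GRing.Theory Num.Theory.
Import numFieldNormedType.Exports.
Local Open Scope classical_set_scope.
Local Open Scope ring_scope.

(** The growth rate [g] is concave, being an integral of the concave functions
    [f |-> ln (1 + f (e^x - 1)) - f x] plus a concave quadratic polynomial, and
    the two limits say that its slope is positive near 0 and negative near 1;
    so [g] has a critical point in the open unit interval, and this point is
    its strict global maximizer.

    Integrability comes first. The mean of the big jumps is the difference of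
    the integrals of the positive and negative parts of [x], with
    [+oo - +oo = -oo]. The two limit conditions exclude the values [-oo] and
    [+oo], hence [x] is integrable over [|x| > 1]
    ([fin_num_integral_integrable]). For [f] in the open unit interval the
    functions [x |-> ln (1 + f (e^x - 1)) - f x] and
    [x |-> (e^x - 1) / (1 + f (e^x - 1)) - x] are therefore dominated by the
    integrable functions [c min(1, x^2) + |x| 1_{|x| > 1}].

    No differentiation under the integral sign is needed. The integral of the
    pointwise derivative is Lipschitz in [f] away from 0 and 1
    ([marginal_mean_lipschitz]), so the intermediate value theorem gives a zero
    [fstar] of the slope ([slope_root]). The inequality [ln y <= y - 1] for
    [y = (1 + f u) / (1 + fstar u)], [u = e^x - 1], says that every integrand
    lies below its tangent at [fstar]; integrating, [g f <= g fstar] for every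
    [f] of the domain, inside the unit interval or not ([growth_rate_lt]).

    The inequality is strict as soon as there are jumps
    ([tangent_log_growth]) or [sigma] is nonzero (strict concavity of the
    quadratic term). If there were neither, the slope would be constant, which
    its change of sign excludes. Uniqueness follows, as each of two strict
    maximizers in the domain would beat the other. *)

(** * Pointwise estimates *)

Section pointwise.
Context {R : realType}.
Implicit Types a f x u : R.

Lemma expR_sub1_sub_le x : `|x| <= 1 -> `|expR x - 1 - x| <= 4 * x ^+ 2.
Proof.
rewrite ler_norml => /andP[x1 x2].
have lo := expR_ge1Dx x.
(* [e^x = (e^(-x/2))^-2] with [e^(-x/2) >= 1 - x/2 >= 1/2] *)
have E : expR x = expR (- (x / 2)) ^- 2.
  by rewrite expRN exprVn invrK -expRM_natl; congr expR; field.
have hb := expR_ge1Dx (- (x / 2)).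
set z := expR (- (x / 2)) in E hb.
have z1 : 1 - x / 2 <= z by lra.
have z0 : 0 < z by lra.
have zE : expR x * z ^+ 2 = 1 by rewrite E mulVf// expf_neq0// gt_eqF.
have Epos := expR_gt0 x.
have hh : expR x * (1 - x / 2) ^+ 2 <= 1.
  by rewrite -[leRHS]zE ler_pM2l// lerXn2r// nnegrE ?(ltW z0)//; lra.
rewrite ger0_norm; last by lra.
have q0 : 1 / 4 <= (1 - x / 2) ^+ 2 by nra.
rewrite -(@ler_pM2r _ ((1 - x / 2) ^+ 2)); last by rewrite exprn_gt0//; lra.
have -> : (expR x - 1 - x) * (1 - x / 2) ^+ 2 =
    expR x * (1 - x / 2) ^+ 2 - 1 + (3 - x) / 4 * x ^+ 2 by field.
have x20 := sqr_ge0 x.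
have h1 : (3 - x) / 4 * x ^+ 2 <= x ^+ 2 by rewrite ler_piMl//; lra.
have h2 : x ^+ 2 <= 4 * x ^+ 2 * (1 - x / 2) ^+ 2.
  by rewrite mulrAC ler_peMl//; lra.
lra.
Qed.

Lemma norm_expR_sub1_le x : `|x| <= 1 -> `|expR x - 1| <= 5 * `|x|.
Proof.
move=> x1; have h := expR_sub1_sub_le x x1.
have -> : expR x - 1 = (expR x - 1 - x) + x by ring.
apply: (le_trans (ler_normD _ _)).
suff : x ^+ 2 <= `|x| by lra.
by rewrite -(real_normK (num_real x)) expr2 ler_piMr.
Qed.

(** [1 + f (e^x - 1)] is the convex combination [(1 - f) + f e^x] of [1] and
    [e^x]; it is the factor by which a jump [x] multiplies the wealth when the
    fraction [f] of it is invested. *)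
Lemma wealth_gt0 f x : 0 < f < 1 -> 0 < 1 + f * (expR x - 1).
Proof. move=> /andP[f0 f1]; have := expR_gt0 x; nra. Qed.

Lemma wealth_ge a f x : 0 < a -> a <= f <= 1 - a ->
  a * (1 + expR x) <= 1 + f * (expR x - 1).
Proof. move=> a0 /andP[f0 f1]; have := expR_gt0 x; nra. Qed.

(** The bound is uniform in [f] and of order [|x|] near 0: the product of two
    such returns is thus dominated by a multiple of [min(1, x^2)]. *)
Lemma norm_return_le a f x : 0 < a -> a <= f <= 1 - a ->
  `|(expR x - 1) / (1 + f * (expR x - 1))| <= 5 / a * Num.min 1 `|x|.
Proof.
move=> a0 faa; have w := wealth_ge a f x a0 faa.
have e0 := expR_gt0 x.
have wa : a <= 1 + f * (expR x - 1) by nra.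
have w0 : 0 < 1 + f * (expR x - 1) by lra.
rewrite normrM normfV (gtr0_norm w0) ler_pdivrMr//.
have -> : 5 / a * Num.min 1 `|x| * (1 + f * (expR x - 1)) =
  5 * Num.min 1 `|x| * ((1 + f * (expR x - 1)) / a) by ring.
case: (leP 1 `|x|) => x1.
  apply: (@le_trans _ _ (1 + expR x)).
    by rewrite ler_norml; apply/andP; split; lra.
  have : 1 + expR x <= (1 + f * (expR x - 1)) / a.
    by rewrite ler_pdivlMr// mulrC.
  lra.
apply: (le_trans (norm_expR_sub1_le x (ltW x1))).
by rewrite ler_peMr ?mulr_ge0// ler_pdivlMr// mul1r.
Qed.

Lemma sqr_minr1_norm x : (Num.min 1 `|x|) ^+ 2 = Num.min 1 (x ^+ 2).
Proof.
have n0 := normr_ge0 x; rewrite -(real_normK (num_real x)).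
by case: (leP 1 `|x|) => x1; case: leP => //; nra.
Qed.

(** Integrable for every Levy measure for which the big jumps have a finite
    mean. *)
Definition dominating a x : R :=
  a * Num.min 1 (x ^+ 2) + (if 1 < `|x| then `|x| else 0).

Lemma norm_marginal_le a f x : 0 < a -> a <= f <= 1 - a ->
  `|(expR x - 1) / (1 + f * (expR x - 1)) - x| <= dominating (9 / a) x.
Proof.
move=> a0 faa; have w := wealth_ge a f x a0 faa.
have e0 := expR_gt0 x.
have wa : a <= 1 + f * (expR x - 1) by nra.
have w0 : 0 < 1 + f * (expR x - 1) by lra.
have r := norm_return_le a f x a0 faa.
have ia : 0 < a^-1 by rewrite invr_gt0.
rewrite /dominating -sqr_minr1_norm; case: (ltP 1 `|x|) => x1.
  apply: (le_trans (ler_normB _ _)); rewrite lerD2r.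
  apply: (le_trans r); rewrite min_l ?(ltW x1)// expr1n; nra.
rewrite addr0 real_normK ?num_real//.
have -> : (expR x - 1) / (1 + f * (expR x - 1)) - x =
    ((expR x - 1 - x) - f * x * (expR x - 1)) / (1 + f * (expR x - 1)).
  by field; lra.
rewrite normrM normfV (gtr0_norm w0) ler_pdivrMr//.
apply: (@le_trans _ _ (9 * x ^+ 2)).
  apply: (le_trans (ler_normB _ _)).
  have h1 := expR_sub1_sub_le x x1.
  have h2 := norm_expR_sub1_le x x1.
  rewrite !normrM (gtr0_norm (_ : 0 < f)); last by lra.
  have := real_normK (num_real x).
  have := normr_ge0 x.
  suff : f * `|x| * `|expR x - 1| <= `|x| * (5 * `|x|) by nra.
  apply: ler_pM => //; first by rewrite mulr_ge0//; lra.
  by rewrite ler_piMl//; lra.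
have -> : 9 / a * x ^+ 2 * (1 + f * (expR x - 1)) =
  9 * x ^+ 2 * ((1 + f * (expR x - 1)) / a) by ring.
have x20 := sqr_ge0 x.
apply: ler_peMr; first by rewrite mulr_ge0.
by rewrite ler_pdivlMr// mul1r.
Qed.

Lemma norm_log_growth_le f x : 0 < f < 1 ->
  `|ln (1 + f * (expR x - 1)) - f * x| <= dominating 4 x.
Proof.
move=> /andP[f0 f1]; have w0 : 0 < 1 + f * (expR x - 1).
  by apply: wealth_gt0; rewrite f0.
have lo : f * x <= ln (1 + f * (expR x - 1)).
  (* concavity of [ln], by averaging [e^t >= 1 + t] at [t = - ln w] and
     [t = x - ln w] with weights [1 - f] and [f] *)
  set w := 1 + _ in w0 *.
  have h1 := expR_ge1Dx (- ln w).
  have h2 := expR_ge1Dx (x - ln w).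
  have h3 : (1 - f) * expR (- ln w) + f * expR (x - ln w) = 1.
    rewrite expRD expRN lnK ?posrE//.
    have -> : (1 - f) * w^-1 + f * (expR x / w) = (1 - f + f * expR x) / w.
      by ring.
    have -> : 1 - f + f * expR x = w by rewrite /w; ring.
    by rewrite divff// gt_eqF.
  have h4 : (1 - f) * (1 - ln w) <= (1 - f) * expR (- ln w).
    by rewrite ler_pM2l//; lra.
  have h5 : f * (1 + (x - ln w)) <= f * expR (x - ln w) by rewrite ler_pM2l.
  lra.
rewrite ger0_norm ?subr_ge0// /dominating.
have up : ln (1 + f * (expR x - 1)) <= f * (expR x - 1).
  by apply: le_ln1Dx; lra.
have m0 : 0 <= Num.min 1 (x ^+ 2) by rewrite le_min ler01 sqr_ge0.
case: (ltP 1 `|x|) => x1.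
  apply: (@le_trans _ _ `|x|); last by lra.
  have [x0|x0] := leP 0 x.
    have : ln (1 + f * (expR x - 1)) <= x.
      rewrite -[leRHS]expRK ler_ln ?posrE ?expR_gt0//.
      have : 1 <= expR x by have := expR_ge1Dx x; lra.
      nra.
    rewrite ger0_norm//; nra.
  have : expR x < 1 by rewrite expR_lt1.
  rewrite ltr0_norm//; nra.
have h1 := expR_sub1_sub_le x x1.
rewrite addr0 min_r; last first.
  by rewrite -(real_normK (num_real x)) expr_le1.
move: h1; rewrite ler_norml => /andP[_ h1].
have := expR_ge1Dx x.
nra.
Qed.

(** The strictly concave function [f |-> ln (1 + f u)] lies strictly below its
    tangent at [f0]. *)
Lemma ln_tangent_lt f f0 u : 0 < 1 + f0 * u -> 0 < 1 + f * u ->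
  u != 0 -> f != f0 ->
  ln (1 + f * u) - ln (1 + f0 * u) < (f - f0) * (u / (1 + f0 * u)).
Proof.
move=> w0 w u0 ff0.
have E : (f - f0) * (u / (1 + f0 * u)) = (1 + f * u) / (1 + f0 * u) - 1.
  by field; lra.
rewrite -ln_div ?posrE// E.
set y := _ / _; have y0 : 0 < y by rewrite divr_gt0.
have y1 : ln y != 0.
  rewrite ln_eq0//; apply/eqP => y1.
  have : (f - f0) * (u / (1 + f0 * u)) = 0 by rewrite E -/y y1 subrr.
  move/eqP; rewrite !mulf_eq0 invr_eq0 subr_eq0 (negPf ff0) (negPf u0)/=.
  by rewrite gt_eqF.
by have := expR_gt1Dx y1; rewrite lnK//; lra.
Qed.

End pointwise.

(** * Integrals *)

(** The integral is the difference of the integrals of the positive and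
    negative parts, and [+oo - +oo = -oo]: if it is finite, so are both. *)
Lemma fin_num_integral_integrable d (T : measurableType d) (R : realType)
  (m : {measure set T -> \bar R}) (D : set T) (f : T -> \bar R) :
  measurable D -> measurable_fun D f ->
  (\int[m]_(x in D) f x)%E \is a fin_num -> m.-integrable D f.
Proof.
move=> mD mf; rewrite integralE => fin; apply/integrableP; split => //.
under eq_integral do rewrite -[`|_|%E]/((abse \o f) _) fune_abse.
rewrite ge0_integralD//; first last.
  exact: measurable_funeneg.
  exact: measurable_funepos.
have : (0 <= \int[m]_(x in D) (f^\+ x))%E by exact: integral_ge0.
have : (0 <= \int[m]_(x in D) (f^\- x))%E by exact: integral_ge0.
move: fin.
case: (\int[m]_(x in D) (f^\+ x))%E => [p||];
  case: (\int[m]_(x in D) (f^\- x))%E => [q||] //=.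
by rewrite -EFinD ltry.
Qed.

Lemma Rintegral_gt0_ae d (T : measurableType d) (R : realType)
  (m : {measure set T -> \bar R}) (D : set T) (f : T -> R) :
  measurable D -> m.-integrable D (EFin \o f) ->
  {ae m, forall x, D x -> 0 < f x} -> m D <> 0%E ->
  0 < \int[m]_(x in D) f x.
Proof.
move=> mD intf f0 mD0; have /integrableP[mf fi] := intf.
have E : (\int[m]_(x in D) (f x)%:E = \int[m]_(x in D) `|(f x)%:E|)%E.
  apply: ae_eq_integral => //; first exact: measurableT_comp.
  by apply: filterS f0 => x h Dx /=; rewrite gtr0_norm// h.
rewrite /Rintegral fine_gt0// E fi andbT lt0e integral_ge0// andbT.
apply/eqP => /(ae_eq_integral_abs m mD mf) f00; apply: mD0.
have : {ae m, forall x, ~ D x}.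
  apply: filterS2 f0 f00 => x fx0 fx Dx.
  by have := fx0 Dx; case: (fx Dx) => ->; rewrite ltxx.
move=> h; apply: measure_negligible => //.
by apply: negligibleS h => x Dx; apply.
Qed.

Section levy.
Context {R : realType} (F : {measure set (measurableTypeR R) -> \bar R}).
Implicit Types a f x : R.

(** The set of possible jump sizes: the nonzero reals. *)
Definition off0 : set R := [set x : R | x != 0].

Lemma measurable_off0 : measurable (off0 : set (measurableTypeR R)).
Proof.
have -> : off0 = ~` [set 0] :> set R by apply/seteqP; split => x /= /eqP.
exact: measurableC.
Qed.

Lemma measurable_big_sizes :
  measurable ([set x | 1 < `|x|] : set (measurableTypeR R)).
Proof.
rewrite -[X in measurable X]setTI.
have := @measurable_fun_ltr _ (measurableTypeR R) R setT (cst 1)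
  (@Num.norm R R).
move=> /(_ (measurable_cst _) (@normr_measurable R setT)).
move=> /(_ measurableT [set true]).
rewrite (_ : _ @^-1` [set true] = [set x | 1 < `|x|]); last first.
  by apply/seteqP; split => x /=.
exact.
Qed.

Lemma measurable_wealth f (D : set (measurableTypeR R)) :
  measurable_fun D (fun x : R => 1 + f * (expR x - 1)).
Proof.
apply: measurable_funD => //; apply: measurable_funM => //.
by apply: measurable_funB => //; exact: measurable_funTS.
Qed.

(** The contribution of the jumps of size [x] to the growth rate, the
    compensator [f x] being subtracted. *)
Definition log_growth f x := ln (1 + f * (expR x - 1)) - f * x.

Lemma measurable_log_growth f (D : set (measurableTypeR R)) :
  measurable_fun D (log_growth f).
Proof.
apply: measurable_funB; last exact: measurable_funM.
apply: (@measurableT_comp _ _ _ _ _ _ (@ln R)); first exact: measurable_ln.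
exact: measurable_wealth.
Qed.

(** The derivative of [log_growth f x] in [f]. *)
Definition marginal f x := (expR x - 1) / (1 + f * (expR x - 1)) - x.

Lemma measurable_marginal f (D : set (measurableTypeR R)) : 0 < f < 1 ->
  measurable_fun D (marginal f).
Proof.
move=> f01.
(* the inverse of a positive number [w] is [exp (- ln w)] *)
have -> : marginal f =
    (fun x => (expR x - 1) * expR (- ln (1 + f * (expR x - 1))) - x).
  apply/funext => x; rewrite /marginal expRN lnK// posrE.
  exact: wealth_gt0.
apply: measurable_funB => //; apply: measurable_funM.
  by apply: measurable_funB => //; exact: measurable_funTS.
apply: (@measurableT_comp _ _ _ _ _ _ (@expR R)) => //.
apply: measurable_funN.
apply: (@measurableT_comp _ _ _ _ _ _ (@ln R)); first exact: measurable_ln.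
exact: measurable_wealth.
Qed.

Hypothesis small_int : (\int[F]_x (Num.min 1 (x ^+ 2))%:E < +oo)%E.
Hypothesis big_fin : big_jump_mean F \is a fin_num.

Lemma integrable_dominating a :
  F.-integrable off0 (EFin \o dominating a).
Proof.
apply: (@integrableS _ _ _ F setT) => //; first exact: measurable_off0.
apply: (@integrableD _ _ _ F setT measurableT
  (fun x => (a * Num.min 1 (x ^+ 2))%:E)
  (fun x => (if 1 < `|x| then `|x| else 0)%:E)).
  under eq_fun do rewrite EFinM.
  apply: integrableZl => //; apply/integrableP; split.
    apply/measurable_EFinP; exact: measurable_minr.
  under eq_integral do rewrite gee0_abs ?lee_fin ?le_min ?ler01 ?sqr_ge0//.
  exact: small_int.
have : F.-integrable [set x | 1 < `|x|] (abse \o (EFin \o @id R)).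
  apply: integrable_abse.
  apply: fin_num_integral_integrable big_fin; first exact: measurable_big_sizes.
  exact/measurable_EFinP.
move/(integrable_mkcond _ measurable_big_sizes).
congr (F.-integrable setT _); apply/funext => x; rewrite /patch.
case: ifPn; first by rewrite inE/= => ->.
by rewrite notin_setE/= => /negP/negPf ->.
Qed.

Lemma integrable_of_le_dominating a (h : R -> R) :
  measurable_fun (off0 : set (measurableTypeR R)) h ->
  (forall x, `|h x| <= dominating a x) -> F.-integrable off0 (EFin \o h).
Proof.
move=> mh hd; apply: le_integrable (integrable_dominating a).
- exact: measurable_off0.
- exact/measurable_EFinP.
- move=> x _ /=; rewrite lee_fin.
  exact: (le_trans (hd x) (ler_norm _)).
Qed.

Lemma integrable_log_growth f : 0 < f < 1 ->
  F.-integrable off0 (EFin \o log_growth f).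
Proof.
move=> f01; apply: (integrable_of_le_dominating 4).
  exact: measurable_log_growth.
by move=> x; exact: norm_log_growth_le.
Qed.

Lemma integrable_marginal f : 0 < f < 1 ->
  F.-integrable off0 (EFin \o marginal f).
Proof.
move=> f01; pose a := Num.min f (1 - f).
have /andP[f0 f1] := f01.
have a0 : 0 < a by rewrite lt_min f0 subr_gt0.
apply: (integrable_of_le_dominating (9 / a)).
  exact: measurable_marginal.
move=> x; apply: norm_marginal_le => //.
have : a <= f by rewrite ge_min lexx.
have : a <= 1 - f by rewrite ge_min lexx orbT.
lra.
Qed.

(** The real-valued version of [marginal_jump_integral]; they agree on the
    open unit interval, where the integral converges. *)
Definition marginal_mean f : R := \int[F]_(x in off0) marginal f x.

Lemma marginal_meanE f : 0 < f < 1 ->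
  marginal_jump_integral F f = (marginal_mean f)%:E.
Proof.
move=> f01; rewrite /marginal_mean /Rintegral fineK//.
apply: integrable_fin_num; first exact: measurable_off0.
exact: integrable_marginal.
Qed.

Lemma marginalB_le a f g x : 0 < a -> a <= f <= 1 - a -> a <= g <= 1 - a ->
  `|marginal f x - marginal g x| <= `|f - g| * dominating (25 / a ^+ 2) x.
Proof.
move=> a0 fa ga.
have wf : 0 < 1 + f * (expR x - 1) by apply: wealth_gt0; lra.
have wg : 0 < 1 + g * (expR x - 1) by apply: wealth_gt0; lra.
have -> : marginal f x - marginal g x = (g - f) *
    ((expR x - 1) / (1 + f * (expR x - 1)) *
     ((expR x - 1) / (1 + g * (expR x - 1)))).
  by rewrite /marginal; field; rewrite !gt_eqF.
rewrite normrM distrC ler_wpM2l// normrM /dominating.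
apply: (@le_trans _ _ (25 / a ^+ 2 * Num.min 1 (x ^+ 2))); last first.
  by rewrite lerDl; case: ifP.
rewrite -sqr_minr1_norm.
have -> : 25 / a ^+ 2 * (Num.min 1 `|x|) ^+ 2 =
    (5 / a * Num.min 1 `|x|) * (5 / a * Num.min 1 `|x|) by field; lra.
by apply: ler_pM => //; exact: norm_return_le.
Qed.

Lemma marginal_mean_lipschitz a : 0 < a -> exists2 k, 0 <= k &
  forall f g, a <= f <= 1 - a -> a <= g <= 1 - a ->
    `|marginal_mean f - marginal_mean g| <= k * `|f - g|.
Proof.
move=> a0; have moff := measurable_off0.
have ge0 x : 0 <= dominating (25 / a ^+ 2) x.
  rewrite /dominating addr_ge0//; last by case: ifP.
  rewrite mulr_ge0 ?le_min ?ler01 ?sqr_ge0// divr_ge0// sqr_ge0//.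
exists (\int[F]_(x in off0) dominating (25 / a ^+ 2) x).
  by apply: Rintegral_ge0 => x _.
move=> f g fa ga.
have f01 : 0 < f < 1 by lra.
have g01 : 0 < g < 1 by lra.
rewrite /marginal_mean -RintegralB//; try exact: integrable_marginal.
have iB : F.-integrable off0 (EFin \o (marginal f \- marginal g)).
  exact: (integrableB moff (integrable_marginal f f01)
    (integrable_marginal g g01)).
apply: (le_trans (le_normr_Rintegral moff iB)).
rewrite mulrC -RintegralZl//; last exact: integrable_dominating.
apply: le_Rintegral => //.
- exact: integrable_abse iB.
- exact: (integrableZl moff `|f - g| (integrable_dominating _)).
- by move=> x _; exact: marginalB_le.
Qed.

Lemma marginal_mean_continuous f : 0 < f < 1 ->
  {for f, continuous marginal_mean}.
Proof.
move=> /andP[f0 f1]; pose a := Num.min f (1 - f) / 2.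
have a0 : 0 < a by rewrite divr_gt0// lt_min f0 subr_gt0.
have af : 2 * a <= f by rewrite mulrC divfK// ge_min lexx.
have a1f : 2 * a <= 1 - f by rewrite mulrC divfK// ge_min lexx orbT.
have [k k0 lip] := marginal_mean_lipschitz a a0.
apply/cvgrPdist_le => e e0; near=> g.
have ge : `|f - g| <= e / (k + 1).
  near: g; apply: cvgr_dist_le; first exact: cvg_id.
  by rewrite divr_gt0// ltr_wpDl.
have : `|f - g| <= a by near: g; apply: cvgr_dist_le; first exact: cvg_id.
rewrite ler_norml => ga.
apply: (le_trans (lip f g _ _)); [lra|lra|].
move: ge; rewrite ler_pdivlMr ?ltr_wpDl// => ge.
have := normr_ge0 (f - g); nra.
Unshelve. all: by end_near. Qed.

(** Strict tangent inequality for the jump part of the growth rate; [f] may lie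
    anywhere in the domain, even outside the unit interval. *)
Lemma tangent_log_growth f g : 0 < g < 1 -> growth_rate_domain F f ->
  f <> g -> F off0 <> 0%E ->
  \int[F]_(x in off0) log_growth f x - \int[F]_(x in off0) log_growth g x <
    (f - g) * marginal_mean g.
Proof.
move=> g01 [wf intf] fg F0; have moff := measurable_off0.
have If : F.-integrable off0 (EFin \o log_growth f).
  apply/integrableP; split; last exact: intf.
  by apply/measurable_EFinP; exact: measurable_log_growth.
have Ig := integrable_log_growth g g01.
have Ik := integrable_marginal g g01.
rewrite -subr_gt0 /marginal_mean -RintegralZl// -RintegralB//.
have IB : F.-integrable off0
    (EFin \o (fun x => log_growth f x - log_growth g x)).
  exact: (integrableB moff If Ig).
have IZ : F.-integrable off0 (EFin \o (fun x => (f - g) * marginal g x)).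
  exact: (integrableZl moff (f - g) Ik).
rewrite -RintegralB//; apply: Rintegral_gt0_ae => //.
  exact: (integrableB moff IZ IB).
have FF := ae_filter_ringOfSetsType F.
apply: filterS wf => x w x0.
have u0 : expR x - 1 != 0.
  rewrite subr_eq0; apply: contra_neq x0 => e.
  by apply: expR_inj; rewrite e expR0.
have := ln_tangent_lt f g (expR x - 1) (wealth_gt0 g x g01) w u0
  (introN eqP fg).
rewrite /log_growth /marginal; lra.
Qed.

Lemma growth_rate_domain_unit f : 0 < f < 1 -> growth_rate_domain F f.
Proof.
move=> f01; split; last by have /integrableP[] := integrable_log_growth f f01.
by apply: aeW => x; exact: wealth_gt0.
Qed.

End levy.

(** * The slope of the growth rate *)

(** A perturbed form of the definition of convergence in the extended reals: it
    also covers an infinite limit [L], as [c0] is finite. *)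
Lemma cvgeD_near_open (R : realType) (I : Type) (G : set_system I)
  (FG : Filter G) (h : I -> \bar R) (c : I -> R) (L : \bar R) (c0 : R)
  (U : set (\bar R)) :
  h @ G --> L -> c @ G --> c0 -> open U -> U (L + c0%:E)%E ->
  \forall i \near G, U (h i + (c i)%:E)%E.
Proof.
move=> hL cc0 oU UL.
have hc : (h \+ (EFin \o c))%E @ G --> (L + c0%:E)%E.
  apply: cvgeD => //; first by rewrite fin_num_adde_defl.
  by apply: cvg_EFin => //; apply: nearW.
by apply: hc; exact: open_nbhs_nbhs.
Qed.

Section slope.
Context {R : realType} (F : {measure set (measurableTypeR R) -> \bar R}).
Context (mu sigma : R).
Hypothesis small_int : (\int[F]_x (Num.min 1 (x ^+ 2))%:E < +oo)%E.
Hypothesis big_fin : big_jump_mean F \is a fin_num.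

(** The derivative of the polynomial part of the growth rate. *)
Definition affine_slope (f : R) : R :=
  mu + fine (big_jump_mean F) + (1 - 2 * f) * (sigma ^+ 2 / 2).

(** The derivative of the growth rate on the open unit interval. *)
Definition slope (f : R) : R := affine_slope f + marginal_mean F f.

Lemma affine_slope_continuous : continuous affine_slope.
Proof.
move=> f; apply: cvgD; first exact: cvg_cst.
apply: cvgMl; apply: cvgB; first exact: cvg_cst.
exact: cvgMr.
Qed.

Lemma slope_root a b : 0 < a -> a <= b -> b < 1 -> 0 < slope a -> slope b < 0 ->
  exists2 f, a <= f <= b & slope f = 0.
Proof.
move=> a0 ab b1 sa sb.
have [||f fab sf] := @IVT R slope a b 0 ab.
- apply: continuous_in_subspaceT => x; rewrite inE/= in_itv/= => /andP[ax xb].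
  apply: cvgD; first exact: affine_slope_continuous.
  by apply: marginal_mean_continuous => //; lra.
- by rewrite ge_min le_max (ltW sb) (ltW sa) orbT.
- by exists f => //; move: fab; rewrite in_itv.
Qed.

(** A critical point is a strict global maximizer, unless the growth rate is an
    affine function. *)
Lemma growth_rate_lt f g : 0 < g < 1 -> slope g = 0 ->
  growth_rate_domain F f -> f <> g -> F off0 <> 0%E \/ sigma <> 0 ->
  growth_rate mu sigma F f < growth_rate mu sigma F g.
Proof.
move=> g01 sg fdom fg nondeg.
rewrite -subr_lt0 /growth_rate.
rewrite -[\int[F]_(x in [set x | 1 < `|x|]) x]/(fine (big_jump_mean F)).
set m := fine _.
set Hf := \int[F]_(x in _) _; set Hg := \int[F]_(x in _) _.
have -> : f * (mu + m) + f * (1 - f) * sigma ^+ 2 / 2 + Hf -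
   (g * (mu + m) + g * (1 - g) * sigma ^+ 2 / 2 + Hg) =
   (f - g) * slope g - (f - g) ^+ 2 * (sigma ^+ 2 / 2) +
   (Hf - Hg - (f - g) * marginal_mean F g).
  by rewrite /slope /affine_slope -/m; field.
rewrite sg mulr0 sub0r.
have fg2 : 0 < (f - g) ^+ 2.
  by rewrite lt0r sqr_ge0 sqrf_eq0 subr_eq0 andbT; apply/eqP.
have s2 := sqr_ge0 sigma.
have [F0|/eqP F0] := eqVneq (F off0) 0%E; last first.
  have := tangent_log_growth F small_int big_fin f g g01 fdom fg F0.
  rewrite -/Hf -/Hg; nra.
(* without jumps all the integrals vanish and the quadratic term decides *)
case: nondeg => // /eqP s0.
have {}s2 : 0 < sigma ^+ 2 by rewrite lt0r sqrf_eq0 s0 s2.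
rewrite /Hf /Hg /marginal_mean /Rintegral.
have moff := @measurable_off0 R.
rewrite !null_set_integral//=; first by nra.
- by apply/measurable_EFinP; exact: measurable_marginal.
- by apply/measurable_EFinP; exact: measurable_log_growth.
- by apply/measurable_EFinP; exact: measurable_log_growth.
Qed.

End slope.

(** * The optimal fraction *)

Theorem theorem4p5 (R : realType) (d : measure_display) (T : measurableType d)
  (P : probability T R) (X B : R -> T -> R) (mu sigma : R)
  (F : {measure set (measurableTypeR R) -> \bar R})
  (sigma_ge0 : 0 <= sigma)
  (levyX : levy_process P X)
  (itoX : levy_ito P X mu sigma B F)
  (X1_integrable : ('E_P[(fun w => `|X 1 w|)%R] < +oo)%E)
  (L0 L1 : \bar R)
  (lim0 : marginal_jump_integral F f @[f --> (0 : R)^'+] --> L0)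
  (lim1 : marginal_jump_integral F f @[f --> (1 : R)^'-] --> L1)
  (L0_gt : (L0 > - (mu%:E + (sigma ^+ 2 / 2)%:E + big_jump_mean F))%E)
  (L1_lt : (L1 < - (mu%:E + big_jump_mean F))%E) :
  exists! fstar : R, 0 < fstar < 1 /\
    forall f, growth_rate_domain F f -> f <> fstar ->
      growth_rate mu sigma F f < growth_rate mu sigma F fstar.
Proof.
have small_int : (\int[F]_x (Num.min 1 (x ^+ 2))%:E < +oo)%E.
  by have [[_ +] _] := levy_ito_measure itoX.
(* [-oo] would contradict [L0_gt], and [+oo] would contradict [L1_lt] *)
have big_fin : big_jump_mean F \is a fin_num.
  move: L0_gt L1_lt; case: (big_jump_mean F) => //=.
  - by case: L0 L1 {lim0 lim1} => [?||] [?||].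
  - by case: L0 L1 {lim0 lim1} => [?||] [?||].
pose m := fine (big_jump_mean F).
have bE : big_jump_mean F = m%:E by rewrite fineK.
have aff := affine_slope_continuous F mu sigma.
have near0 : \forall f \near (0 : R)^'+,
    (0 < marginal_jump_integral F f + (affine_slope F mu sigma f)%:E)%E.
  apply: (@cvgeD_near_open _ _ _ _ _ _ L0 (affine_slope F mu sigma 0)
    [set y | (0 < y)%E]) => //.
  - exact: (cvg_at_right_filter (aff 0)).
  - exact: open_ereal_gt_ereal.
  - move: L0_gt; rewrite bE /affine_slope -/m /=.
    by case: (L0) => [l||]//=; rewrite -?EFinD -?EFinN ?lte_fin ?ltry//; lra.
have near1 : \forall f \near (1 : R)^'-,
    (marginal_jump_integral F f + (affine_slope F mu sigma f)%:E < 0)%E.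
  apply: (@cvgeD_near_open _ _ _ _ _ _ L1 (affine_slope F mu sigma 1)
    [set y | (y < 0)%E]) => //.
  - exact: (cvg_at_left_filter (aff 1)).
  - exact: open_ereal_lt_ereal.
  - move: L1_lt; rewrite bE /affine_slope -/m /=.
    have s20 := sqr_ge0 sigma.
    by case: (L1) => [l||]//=; rewrite -?EFinD -?EFinN ?lte_fin ?ltNyr//; lra.
have slopeE f : 0 < f < 1 ->
    (marginal_jump_integral F f + (affine_slope F mu sigma f)%:E)%E =
    (slope F mu sigma f)%:E.
  by move=> f01; rewrite marginal_meanE// -EFinD addrC.
have [a a01 sa] : exists2 a, 0 < a < 1 / 2 & 0 < slope F mu sigma a.
  near (0 : R)^'+ => a.
  have a01 : 0 < a < 1 / 2.
    apply/andP; split; near: a; first exact: nbhs_right_gt.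
    by apply: nbhs_right_lt; lra.
  exists a => //; rewrite -lte_fin -slopeE; last by lra.
  by near: a.
have [b b01 sb] : exists2 b, 1 / 2 < b < 1 & slope F mu sigma b < 0.
  near (1 : R)^'- => b.
  have b01 : 1 / 2 < b < 1.
    apply/andP; split; near: b; last exact: nbhs_left_lt.
    by apply: nbhs_left_gt; lra.
  exists b => //; rewrite -lte_fin -slopeE; last by lra.
  by near: b.
have [f fab sf] : exists2 f, a <= f <= b & slope F mu sigma f = 0.
  by apply: slope_root => //; lra.
have f01 : 0 < f < 1 by lra.
have nondeg : F off0 <> 0%E \/ sigma <> 0.
  have [F0|/eqP F0] := eqVneq (F off0) 0%E; last by left.
  (* with neither jumps nor a Gaussian part the slope would be constant *)
  right => s0; move: sa sb; rewrite /slope /affine_slope s0.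
  rewrite /marginal_mean /Rintegral.
  have moff := @measurable_off0 R.
  rewrite !null_set_integral//=; first by lra.
  - by apply/measurable_EFinP; apply: measurable_marginal; lra.
  - by apply/measurable_EFinP; apply: measurable_marginal; lra.
have fmax g : growth_rate_domain F g -> g <> f ->
    growth_rate mu sigma F g < growth_rate mu sigma F f.
  by move=> gdom gf; exact: growth_rate_lt.
exists f; split => // g [g01 gmax]; apply: contrapT => fg.
have h1 := gmax f (growth_rate_domain_unit F small_int big_fin f f01) fg.
have h2 := fmax g (growth_rate_domain_unit F small_int big_fin g g01)
  (nesym fg).
by have := lt_trans h1 h2; rewrite ltxx.
Unshelve. all: by end_near. Qed.
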